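(* Let $n\ge 3$, and let $g_0$ be the standard metric of the unit sphere $\mathbb{S}^n$. (1) Let $\Omega\subset\mathbb{S}^n$ be a domain and let $\phi:\Omega\to\mathbb{H}^{n+1}$ be a locally horospherically convex hypersurface with hyperbolic Gauss map $G(x)=x$ and horospherical support function $e^{\rho}:\Omega\to(0,+\infty)$, and let $g=e^{2\rho}g_0$ be its horospherical metric. Let $T|_{\mathbb{H}^{n+1}}$ be an isometry of $\mathbb{H}^{n+1}$ and let $\Phi\in\mathcal{D}(\mathbb{S}^n)$ be its associated conformal diffeomorphism. If $\phi$ is $T|_{\mathbb{H}^{n+1}}$-invariant, then $g$ is $\Phi$-invariant. (2) Conversely, let $g=e^{2\rho}g_0$ be a conformal metric defined on a domain $\Omega\subset\mathbb{S}^n$ such that the eigenvalues of its Schouten tensor ${\rm Sch}_g$ are less than $1/2$. Let $\Phi\in\mathcal{D}(\mathbb{S}^n)$ be a conformal diffeomorphism and let $T|_{\mathbb{H}^{n+1}}$ be its associated isometry of $\mathbb{H}^{n+1}$. If $g$ is $\Phi$-invariant, then the hypersurface $\phi:\Omega\to\mathbb{H}^{n+1}$ given by $$\phi(x)=\frac{e^{\rho}}{2}\left(1+e^{-2\rho}\left(1+\|\nabla^{g_0}\rho\|_{g_0}^2\right)\right)(1,x)+e^{-\rho}\left(0,-x+\nabla^{g_0}\rho\right)$$ is $T|_{\mathbb{H}^{n+1}}$-invariant.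
   Context: Let $\mathbb{L}^{n+2}$ be $\mathbb{R}^{n+2}$ with coordinates $(x_0,\ldots,x_{n+1})$ and the Lorentzian metric $\langle x,x\rangle=-x_0^2+\sum_{i=1}^{n+1}x_i^2$. Set $\mathbb{H}^{n+1}=\{\langle x,x\rangle=-1,\ x_0>0\}$, $\mathbb{S}^{n+1}_1=\{\langle x,x\rangle=1\}$, $\mathbb{N}^{n+1}_+=\{\langle x,x\rangle=0,\ x_0>0\}$, and identify $\mathbb{S}^n$ with $\mathbb{N}^{n+1}_+\cap\{x_0=1\}$ via $x\mapsto(1,x)$. For an oriented immersed hypersurface $\phi:M^n\to\mathbb{H}^{n+1}$ with unit normal $\eta:M^n\to\mathbb{S}^{n+1}_1$, the associated light cone map is $\psi=\phi+\eta:M^n\to\mathbb{N}^{n+1}_+$; writing $\psi=e^{\rho}(1,G)$ defines the horospherical support function $e^{\rho}$ and the hyperbolic Gauss map $G:M^n\to\mathbb{S}^n$. The hypersurface is (locally) horospherically convex if at every point $p$ it is horospherically convex: there is a neighborhood $V$ of $p$ such that $V\setminus\{p\}$ does not meet the horosphere tangent to the hypersurface at $p$ whose interior unit normal at $p$ is $\eta(p)$, and the distance function of the hypersurface to that horosphere does not vanish up to second order at $p$ in any direction (equivalently, all principal curvatures at $p$ are simultaneously $<1$ or simultaneously $>1$). The horospherical metric is $g=e^{2\rho}\langle dG,dG\rangle_{\mathbb{S}^n}$; when $M^n=\Omega\subset\mathbb{S}^n$ and $G(x)=x$ it equals $e^{2\rho}g_0$. Schouten tensor: ${\rm Sch}_g=\frac{1}{n-2}\left({\rm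 Ric}_g-\frac{S(g)}{2(n-1)}g\right)$, with ${\rm Ric}_g$ the Ricci tensor and $S(g)$ the scalar curvature; its eigenvalues are those of $g^{-1}{\rm Sch}_g$. $\mathcal{D}(\mathbb{S}^n)$ is the group of conformal diffeomorphisms of $\mathbb{S}^n$. Each $\Phi\in\mathcal{D}(\mathbb{S}^n)$, with conformal factor $e^{\omega}$ (i.e. $\Phi^*g_0=e^{2\omega}g_0$), is associated with a unique isometry $T$ of $\mathbb{L}^{n+2}$ preserving $\mathbb{H}^{n+1}$ and $\mathbb{N}^{n+1}_+$, and vice versa; the association is $T(e^{t}(1,x))=e^{t-\omega(x)}(1,\Phi(x))$ on $\mathbb{N}^{n+1}_+$. The isometry of $\mathbb{H}^{n+1}$ associated with $\Phi$ is the restriction $T|_{\mathbb{H}^{n+1}}$; every isometry of $\mathbb{H}^{n+1}$ arises this way from a unique $\Phi$. Invariance. A conformal metric $g$ on $\Omega\subset\mathbb{S}^n$ is $\Phi$-invariant if $g_x(u,v)=(\Phi^*g)_x(u,v)$ for all $x\in\Omega$ with $\Phi(x)\in\Omega$ and all $u,v\in T_x\mathbb{S}^n$. A hypersurface $\phi:M^n\subset N^n\to\mathbb{H}^{n+1}$, with $M^n$ a domain of an $n$-manifold $N^n$ (here $M=\Omega$, $N=\mathbb{S}^n$), is $T|_{\mathbb{H}^{n+1}}$-invariant if there is a diffeomorphism $i_T:N^n\to N^n$ such that $T(\phi(p))=\phi(i_T(p))$ for all $p\in M^n$ with $i_T(p)\in M^n$.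
   Formalization: T-invariance also requires that T preserve the orientation (⟨Tη(p),η(i_T(p))⟩>0) and that i_T(p)∈Ω whenever p,Φ(p)∈Ω; with the literal definition (1) fails, e.g. for a small cap Ω with i_T the antipodal map. *)

(* Defs.v *)
From mathcomp Require Import all_boot all_order all_algebra.
From mathcomp Require Import all_classical all_reals all_analysis.

Set Implicit Arguments.
Unset Strict Implicit.
Unset Printing Implicit Defensive.

Import Order.TTheory GRing.Theory Num.Theory.
Import numFieldNormedType.Exports.

Local Open Scope classical_set_scope.
Local Open Scope ring_scope.

Section Smooth.
Context {R : realType} {V W : normedModType R}.

(* [O] is meant to be open. *)
Fixpoint Ck (k : nat) (O : set V) (f : V -> W) : Prop :=
  match k with
  | 0%N => forall x, O x -> {for x, continuous f}
  | k'.+1 => (forall x, O x -> differentiable f x) /\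
             (forall v, Ck k' O (fun x => 'D_v f x))
  end.

Definition smooth_on (O : set V) (f : V -> W) : Prop := forall k, Ck k O f.

End Smooth.

Section Sphere.
Context {R : realType} {n : nat}.

Definition dot {m : nat} (u v : 'rV[R]_m) : R := \sum_i u 0 i * v 0 i.

Definition sphere : set 'rV[R]_n.+1 := [set x | dot x x = 1].

Definition tangent (x v : 'rV[R]_n.+1) : Prop := dot x v = 0.

Definition sphere_open (Om : set 'rV[R]_n.+1) : Prop :=
  exists2 O, open O & Om = O `&` sphere.

Definition sphere_domain (Om : set 'rV[R]_n.+1) : Prop :=
  [/\ Om !=set0, sphere_open Om & connected Om].

Definition normalize (y : 'rV[R]_n.+1) : 'rV[R]_n.+1 :=
  (Num.sqrt (dot y y))^-1 *: y.

(* A map on an open subset [Om] of the sphere is differentiated through its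
   extension to the open cone over [Om] that is constant along rays: it is
   smooth iff this extension is, and its differential at [x] is the
   restriction to the tangent space at [x] of that of the extension. *)
Definition radial {W : Type} (f : 'rV[R]_n.+1 -> W) : 'rV[R]_n.+1 -> W :=
  fun y => f (normalize y).

Definition cone (Om : set 'rV[R]_n.+1) : set 'rV[R]_n.+1 :=
  [set y | y != 0 /\ Om (normalize y)].

Definition sphere_smooth {W : normedModType R} (Om : set 'rV[R]_n.+1)
    (f : 'rV[R]_n.+1 -> W) : Prop :=
  smooth_on (cone Om) (radial f).

Definition sdiff {W : normedModType R} (f : 'rV[R]_n.+1 -> W)
    (x v : 'rV[R]_n.+1) : W := 'D_v (radial f) x.

(* The radial derivative of [radial f] vanishes, so its Euclidean gradient at a
   point of the sphere is tangent and represents the differential of [f]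
   with respect to the round metric. *)
Definition sgrad (f : 'rV[R]_n.+1 -> R) (x : 'rV[R]_n.+1) : 'rV[R]_n.+1 :=
  \row_j sdiff (f : _ -> R^o) x (delta_mx 0 j).

Definition sphere_diffeo (F : 'rV[R]_n.+1 -> 'rV[R]_n.+1) : Prop :=
  exists F' : 'rV[R]_n.+1 -> 'rV[R]_n.+1,
    [/\ forall x, sphere x -> sphere (F x) /\ sphere (F' x),
        sphere_smooth sphere F, sphere_smooth sphere F',
        forall x, sphere x -> F' (F x) = x
      & forall x, sphere x -> F (F' x) = x].

(* F^* g_0 = e^(2 om) g_0 *)
Definition conformal_diffeo (F : 'rV[R]_n.+1 -> 'rV[R]_n.+1)
    (om : 'rV[R]_n.+1 -> R) : Prop :=
  sphere_diffeo F /\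
  forall x u v, sphere x -> tangent x u -> tangent x v ->
    dot (sdiff F x u) (sdiff F x v) = expR (2 * om x) * dot u v.

(* g = e^(2 rho) g_0 *)
Definition conf_metric (rho : 'rV[R]_n.+1 -> R) (x u v : 'rV[R]_n.+1) : R :=
  expR (2 * rho x) * dot u v.

Definition metric_invariant (Om : set 'rV[R]_n.+1)
    (g : 'rV[R]_n.+1 -> 'rV[R]_n.+1 -> 'rV[R]_n.+1 -> R)
    (F : 'rV[R]_n.+1 -> 'rV[R]_n.+1) : Prop :=
  forall x, Om x -> Om (F x) ->
  forall u v, tangent x u -> tangent x v ->
    g x u v = g (F x) (sdiff F x u) (sdiff F x v).

End Sphere.

Section Curvature.
Context {R : realType} {n : nat}.
Variable g : 'rV[R]_n -> 'M[R]_n.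

Definition pd (i : 'I_n) (f : 'rV[R]_n -> R) (u : 'rV[R]_n) : R :=
  'D_(delta_mx 0 i) (f : _ -> R^o) u.

(* Gamma^k_ij *)
Definition christoffel (k i j : 'I_n) (u : 'rV[R]_n) : R :=
  2^-1 * \sum_l invmx (g u) k l *
    (pd i (fun w => g w j l) u + pd j (fun w => g w i l) u
     - pd l (fun w => g w i j) u).

Definition ricci (u : 'rV[R]_n) : 'M[R]_n := \matrix_(j, k)
  (\sum_i (pd i (christoffel i j k) u - pd j (christoffel i i k) u)
   + \sum_i \sum_l (christoffel i i l u * christoffel l j k u
                    - christoffel i j l u * christoffel l i k u)).

Definition scalar_curv (u : 'rV[R]_n) : R := \tr (invmx (g u) *m ricci u).

Definition schouten (u : 'rV[R]_n) : 'M[R]_n :=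
  (n%:R - 2)^-1 *: (ricci u - (scalar_curv u / (2 * (n%:R - 1))) *: g u).

End Curvature.

Section SchoutenSphere.
Context {R : realType} {n : nat}.

Definition local_param (Om : set 'rV[R]_n.+1) (U : set 'rV[R]_n)
    (X : 'rV[R]_n -> 'rV[R]_n.+1) : Prop :=
  [/\ open U, smooth_on U X, forall u, U u -> Om (X u),
      forall u w, U u -> U w -> X u = X w -> u = w
    & forall u v, U u -> 'D_v X u = 0 -> v = 0].

Definition param_metric
    (g : 'rV[R]_n.+1 -> 'rV[R]_n.+1 -> 'rV[R]_n.+1 -> R)
    (X : 'rV[R]_n -> 'rV[R]_n.+1) (u : 'rV[R]_n) : 'M[R]_n :=
  \matrix_(i, j) g (X u) ('D_(delta_mx 0 i) X u) ('D_(delta_mx 0 j) X u).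

Definition schouten_eigenvalues_lt (Om : set 'rV[R]_n.+1)
    (g : 'rV[R]_n.+1 -> 'rV[R]_n.+1 -> 'rV[R]_n.+1 -> R) (c : R) : Prop :=
  forall U X, local_param Om U X ->
  forall u, U u ->
  forall a, eigenvalue (invmx (param_metric g X u)
                        *m schouten (param_metric g X) u) a -> a < c.

End SchoutenSphere.

Section Hyperbolic.
Context {R : realType} {n : nat}.

(* Minkowski space is 'rV_(1 + n.+1); the time coordinate comes first. *)
Definition lpt (t : R) (x : 'rV[R]_n.+1) : 'rV[R]_(1 + n.+1) :=
  row_mx t%:M x.

Definition time (u : 'rV[R]_(1 + n.+1)) : R := lsubmx u 0 0.

Definition lorentz (u v : 'rV[R]_(1 + n.+1)) : R :=
  - (time u * time v) + dot (rsubmx u) (rsubmx v).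

Definition hyp : set 'rV[R]_(1 + n.+1) :=
  [set u | lorentz u u = -1 /\ 0 < time u].

Definition de_sitter : set 'rV[R]_(1 + n.+1) := [set u | lorentz u u = 1].

Definition light_cone : set 'rV[R]_(1 + n.+1) :=
  [set u | lorentz u u = 0 /\ 0 < time u].

Definition lorentz_isometry
    (T : {linear 'rV[R]_(1 + n.+1) -> 'rV[R]_(1 + n.+1)}) : Prop :=
  [/\ forall u v, lorentz (T u) (T v) = lorentz u v,
      T @` hyp = hyp & T @` light_cone = light_cone].

Definition associated
    (T : {linear 'rV[R]_(1 + n.+1) -> 'rV[R]_(1 + n.+1)})
    (F : 'rV[R]_n.+1 -> 'rV[R]_n.+1) (om : 'rV[R]_n.+1 -> R) : Prop :=
  forall t x, sphere x ->
    T (expR t *: lpt 1 x) = expR (t - om x) *: lpt 1 (F x).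

Definition hypersurface (Om : set 'rV[R]_n.+1)
    (phi eta : 'rV[R]_n.+1 -> 'rV[R]_(1 + n.+1)) : Prop :=
  [/\ sphere_smooth Om phi /\ sphere_smooth Om eta,
      forall x, Om x -> hyp (phi x) /\ de_sitter (eta x),
      forall x v, Om x -> tangent x v -> sdiff phi x v = 0 -> v = 0,
      forall x, Om x -> lorentz (eta x) (phi x) = 0
    & forall x v, Om x -> tangent x v -> lorentz (eta x) (sdiff phi x v) = 0].

Definition acosh (t : R) : R := ln (t + Num.sqrt (t ^+ 2 - 1)).

Definition hdist (y z : 'rV[R]_(1 + n.+1)) : R := acosh (- lorentz y z).

Definition hdist_set (y : 'rV[R]_(1 + n.+1)) (S : set 'rV[R]_(1 + n.+1)) : R :=
  inf [set hdist y z | z in S].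

(* For [a] in the light cone; the interior unit normal at [y] is [a - y]. *)
Definition horosphere (a : 'rV[R]_(1 + n.+1)) : set 'rV[R]_(1 + n.+1) :=
  [set y | hyp y /\ lorentz y a = -1].

Definition tangent_horosphere (phi eta : 'rV[R]_n.+1 -> 'rV[R]_(1 + n.+1))
    (p : 'rV[R]_n.+1) : set 'rV[R]_(1 + n.+1) := horosphere (phi p + eta p).

(* Vanishing up to second order in the direction [v] is d = o(t^2) along the
   great circle through [p] with velocity [v]. *)
Definition horo_convex_at (Om : set 'rV[R]_n.+1)
    (phi eta : 'rV[R]_n.+1 -> 'rV[R]_(1 + n.+1)) (p : 'rV[R]_n.+1) : Prop :=
  (exists2 V : set 'rV[R]_n.+1, open V /\ V p &
     forall q, V q -> Om q -> q <> p -> ~ tangent_horosphere phi eta p (phi q))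
  /\
  (forall v, tangent p v -> v != 0 ->
     ~ ((fun t : R => hdist_set (phi (normalize (p + t *: v)))
                        (tangent_horosphere phi eta p) / t ^+ 2)
          @ 0^' --> (0 : R))).

Definition horo_convex (Om : set 'rV[R]_n.+1)
    (phi eta : 'rV[R]_n.+1 -> 'rV[R]_(1 + n.+1)) : Prop :=
  forall p, Om p -> horo_convex_at Om phi eta p.

(* psi = phi + eta = e^rho (1, G) *)
Definition has_support_gauss (Om : set 'rV[R]_n.+1)
    (phi eta : 'rV[R]_n.+1 -> 'rV[R]_(1 + n.+1))
    (rho : 'rV[R]_n.+1 -> R) (G : 'rV[R]_n.+1 -> 'rV[R]_n.+1) : Prop :=
  forall x, Om x -> phi x + eta x = expR (rho x) *: lpt 1 (G x).

(* Invariance of the oriented hypersurface [phi], with Gauss map the identity,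
   under the isometry [T] acting on the ideal boundary by [F].  The first
   clause alone holds for every [phi] and [T] as soon as some diffeomorphism
   of the sphere moves [Om] off itself.  The last clause excludes this; the
   second one says that [T] respects the orientation: by the first, [T]
   maps the normal at [p] to plus or minus the normal at [iT p]. *)
Definition isometry_invariant (Om : set 'rV[R]_n.+1)
    (phi eta : 'rV[R]_n.+1 -> 'rV[R]_(1 + n.+1))
    (T : {linear 'rV[R]_(1 + n.+1) -> 'rV[R]_(1 + n.+1)})
    (F : 'rV[R]_n.+1 -> 'rV[R]_n.+1) : Prop :=
  exists iT : 'rV[R]_n.+1 -> 'rV[R]_n.+1,
    [/\ sphere_diffeo iT,
        forall p, Om p -> Om (iT p) -> T (phi p) = phi (iT p),
        forall p, Om p -> Om (iT p) -> 0 < lorentz (T (eta p)) (eta (iT p))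
      & forall p, Om p -> Om (F p) -> Om (iT p)].

Definition repr_hypersurface (rho : 'rV[R]_n.+1 -> R) (x : 'rV[R]_n.+1) :
    'rV[R]_(1 + n.+1) :=
  (expR (rho x) / 2 *
     (1 + expR (- 2 * rho x) * (1 + dot (sgrad rho x) (sgrad rho x))))
    *: lpt 1 x
  + expR (- rho x) *: lpt 0 (- x + sgrad rho x).

(* The unit normal for which the light cone map is e^rho (1, x). *)
Definition repr_normal (rho : 'rV[R]_n.+1 -> R) (x : 'rV[R]_n.+1) :
    'rV[R]_(1 + n.+1) :=
  expR (rho x) *: lpt 1 x - repr_hypersurface rho x.

End Hyperbolic.

(* Main.v *)
Require Import Defs.
From HB Require Import structures.
From mathcomp Require Import all_boot all_order all_algebra.
From mathcomp Require Import all_classical all_reals all_analysis.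
From mathcomp Require Import ring lra.
Import Order.TTheory GRing.Theory Num.Theory.
Import numFieldNormedType.Exports.
Local Open Scope classical_set_scope.
Local Open Scope ring_scope.

(* As [Phi] is conformal, [g] is [Phi]-invariant iff
   [rho = rho \o Phi + om] where this makes sense, that is, iff [T] maps the
   light cone map [psi = e^rho (1, x)] at [x] to [psi] at [Phi x].  The
   hypersurface [phi] and [psi] determine each other to first order: [psi - phi]
   is the unit normal of [phi], and [phi] is the only solution of
   [<phi, phi> = <phi, psi> = -1], [<phi, d psi> = 0].  Both characterizations
   are Lorentz invariant, so [T] permutes the values of [phi] iff it permutes
   those of [psi], and then the induced map of the sphere is [Phi]. *)

Set Implicit Arguments.
Unset Strict Implicit.

(** * Euclidean and Lorentzian bilinear algebra *)

Section Algebra.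
Context {R : realType}.

Lemma dotC m (u v : 'rV[R]_m) : dot u v = dot v u.
Proof. by apply: eq_bigr => i _; rewrite mulrC. Qed.

Lemma dotDl m (u v w : 'rV[R]_m) : dot (u + v) w = dot u w + dot v w.
Proof. by rewrite -big_split; apply: eq_bigr => i _; rewrite mxE mulrDl. Qed.

Lemma dotZl m a (u v : 'rV[R]_m) : dot (a *: u) v = a * dot u v.
Proof. by rewrite mulr_sumr; apply: eq_bigr => i _; rewrite mxE mulrA. Qed.

Lemma dotDr m (u v w : 'rV[R]_m) : dot w (u + v) = dot w u + dot w v.
Proof. by rewrite dotC dotDl !(dotC _ w). Qed.

Lemma dotZr m a (u v : 'rV[R]_m) : dot v (a *: u) = a * dot v u.
Proof. by rewrite dotC dotZl dotC. Qed.

Lemma dotNl m (u v : 'rV[R]_m) : dot (- u) v = - dot u v.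
Proof. by rewrite -scaleN1r dotZl mulN1r. Qed.

Lemma dotNr m (u v : 'rV[R]_m) : dot v (- u) = - dot v u.
Proof. by rewrite dotC dotNl dotC. Qed.

Lemma dot_self_eq0 m (u : 'rV[R]_m) : dot u u = 0 -> u = 0.
Proof.
move=> /eqP; rewrite psumr_eq0; last by move=> i _; rewrite -expr2 sqr_ge0.
move=> /allP h; apply/rowP => i; have := h i (mem_index_enum i).
by rewrite mulf_eq0 orbb mxE => /eqP.
Qed.

(** The component of [p] orthogonal to [y] is itself tangent, hence orthogonal both to [p] and to
    [y], hence to itself. *)
Lemma dot_tangent_eq n (y p : 'rV[R]_n.+1) : sphere y ->
  (forall w, tangent y w -> dot p w = 0) -> p = dot p y *: y.
Proof.
move=> hy hp; apply/eqP; rewrite -subr_eq0; apply/eqP/dot_self_eq0.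
have hy' : dot y y = 1 by [].
have t : tangent y (p - dot p y *: y).
  by rewrite /tangent dotDr dotNr dotZr hy' mulr1 (dotC y) subrr.
by rewrite dotDl dotNl dotZl (hp _ t) t mulr0 subr0.
Qed.

(** The tangent space is the kernel of the column [x^T], whose rank is at most 1, less than
    [n.+1]. *)
Lemma exists_tangent n (x : 'rV[R]_n.+1) : (0 < n)%N ->
  exists2 v, tangent x v & v != 0.
Proof.
move=> n0; have : kermx x^T != 0.
  rewrite -mxrank_eq0 mxrank_ker -lt0n subn_gt0.
  by rewrite (leq_ltn_trans (rank_leq_col _)).
move=> /matrix0Pn[i [j hij]].
exists (row i (kermx x^T)); last first.
  apply: contra hij => /eqP/rowP/(_ j).
  by rewrite [in X in X -> _]mxE [in X in _ = X -> _]mxE => ->.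
have : row i (kermx x^T) *m x^T = 0 by rewrite -row_mul mulmx_ker row0.
move=> /matrixP/(_ 0 0); rewrite mxE => h.
rewrite /tangent; transitivity ((0 : 'M[R]_1) 0 0);
  last by rewrite mxE.
rewrite -h.
by apply: eq_bigr => k _; rewrite mulrC [x^T _ _]mxE.
Qed.

Context {n : nat}.
Local Notation L := 'rV[R]_(1 + n.+1).

Lemma timeD (u v : L) : time (u + v) = time u + time v.
Proof. by rewrite /time !mxE. Qed.

Lemma timeZ a (u : L) : time (a *: u) = a * time u.
Proof. by rewrite /time !mxE. Qed.

Lemma rsubmxD (u v : L) : rsubmx (u + v) = rsubmx u + rsubmx v.
Proof. by apply/rowP => i; rewrite !mxE. Qed.

Lemma rsubmxZ a (u : L) : rsubmx (a *: u) = a *: rsubmx u.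
Proof. by apply/rowP => i; rewrite !mxE. Qed.

Lemma lorentzC (u v : L) : lorentz u v = lorentz v u.
Proof. by rewrite /lorentz dotC mulrC. Qed.

Lemma lorentzDl (u v w : L) : lorentz (u + v) w = lorentz u w + lorentz v w.
Proof. by rewrite /lorentz timeD rsubmxD dotDl; ring. Qed.

Lemma lorentzZl a (u v : L) : lorentz (a *: u) v = a * lorentz u v.
Proof. by rewrite /lorentz timeZ rsubmxZ dotZl; ring. Qed.

Lemma lorentzDr (u v w : L) : lorentz w (u + v) = lorentz w u + lorentz w v.
Proof. by rewrite lorentzC lorentzDl !(lorentzC _ w). Qed.

Lemma lorentzZr a (u v : L) : lorentz v (a *: u) = a * lorentz v u.
Proof. by rewrite lorentzC lorentzZl lorentzC. Qed.

Lemma lorentzBl (u v w : L) : lorentz (u - v) w = lorentz u w - lorentz v w.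
Proof. by rewrite lorentzDl -scaleN1r lorentzZl mulN1r. Qed.

Lemma lorentz0l (u : L) : lorentz 0 u = 0.
Proof. by rewrite -(scale0r u) lorentzZl mul0r. Qed.

Lemma lorentz_lptr (P : L) t (x : 'rV[R]_n.+1) :
  lorentz P (lpt t x) = - (time P * t) + dot (rsubmx P) x.
Proof. by rewrite /lorentz /time /lpt row_mxKl row_mxKr [t%:M _ _]mxE mulr1n. Qed.

Lemma lpt_eta (P : L) : P = lpt (time P) (rsubmx P).
Proof.
rewrite -[LHS]hsubmxK /lpt; congr row_mx.
by apply/matrixP => i j; rewrite !ord1 [RHS]mxE mulr1n.
Qed.

(** Pairing with (1, 0) kills the time coordinate; pairing with the spatial part of [u] kills the
    rest, the form being definite there. *)
Lemma lorentz_nondeg (u : L) : (forall v, lorentz u v = 0) -> u = 0.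
Proof.
move=> h; have ht : time u = 0.
  have := h (lpt 1 0); rewrite lorentz_lptr -(scale0r 0) dotZr mul0r addr0.
  by rewrite mulr1 => /eqP; rewrite oppr_eq0 => /eqP.
have hr : rsubmx u = 0.
  by apply: dot_self_eq0; have := h (lpt 0 (rsubmx u));
    rewrite lorentz_lptr mulr0 oppr0 add0r.
by rewrite [u]lpt_eta ht hr /lpt raddf0 row_mx0.
Qed.

(* [A] stands for a differential on the tangent space at [y], extended by 0 in
   the normal direction. *)
Lemma unit_normal_unique (y : 'rV[R]_n.+1) (phi e N : L)
    (A : {linear 'rV[R]_n.+1 -> L}) :
  sphere y -> A y = 0 ->
  lorentz phi phi = -1 -> lorentz e e = 1 -> lorentz e phi = 0 ->
  (forall w, lorentz phi (A w) = 0) -> (forall w, lorentz e (A w) = 0) ->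
  (forall w, tangent y w -> A w = 0 -> w = 0) ->
  lorentz N phi = 0 -> (forall w, lorentz N (A w) = 0) ->
  lorentz N N = 1 -> 0 < lorentz N e -> N = e.
Proof.
move=> hy Ay pp ee ep pA eA inj Np NA NN Ne.
have hy' : dot y y = 1 by [].
(* The frame [phi], [e], range of [A] is packed into one endomorphism of Minkowski space: the
   direction [y], which [A] kills, carries the coefficient of [e]. Injectivity then gives
   surjectivity, so the frame spans. *)
pose C (c : L) : L := time c *: phi + dot (rsubmx c) y *: e + A (rsubmx c).
have linC : linear C.
  move=> a u v; rewrite /C timeD timeZ rsubmxD rsubmxZ dotDl dotZl !linearP /=.
  rewrite !scalerDr !scalerDl !scalerA.
  by rewrite !addrA; apply/rowP => i; rewrite !mxE; ring.
pose HC := GRing.isLinear.Build _ _ _ _ C linC.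
pose Cl : {linear L -> L} := HB.pack C HC.
have injC u : C u = 0 -> u = 0.
  move=> hu.
  have b : dot (rsubmx u) y = 0.
    have := congr1 (lorentz^~ e) hu; rewrite /= lorentz0l /C !lorentzDl !lorentzZl.
    by rewrite ee (lorentzC phi) ep (lorentzC (A _)) eA mulr0 add0r addr0 mulr1.
  have a : time u = 0.
    have := congr1 (lorentz^~ phi) hu; rewrite /= lorentz0l /C !lorentzDl !lorentzZl.
    rewrite pp ep (lorentzC (A _)) pA mulr0 !addr0 mulrN1 => /eqP.
    by rewrite oppr_eq0 => /eqP.
  have w : rsubmx u = 0.
    apply: inj; first by rewrite /tangent dotC.
    by move: hu; rewrite /C a b !scale0r !add0r.
  by rewrite [u]lpt_eta a w /lpt raddf0 row_mx0.
have unitC : lin1_mx Cl \in unitmx.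
  rewrite -row_free_unit; apply: inj_row_free => v.
  by rewrite mul_rV_lin1; exact: injC.
have surjC v : exists c, C c = v.
  exists (v *m invmx (lin1_mx Cl)).
  by rewrite -[C _]/(Cl _) -mul_rV_lin1 mulmxKV.
(* This vector is orthogonal to [phi], to [e] and to the range of [A], hence to everything. *)
have NE : N - lorentz N e *: e = 0.
  apply: lorentz_nondeg => v; have [c <-] := surjC v.
  rewrite /C !lorentzDr !lorentzZr !lorentzBl !lorentzZl Np ep NA eA ee.
  by ring.
move/eqP: NE; rewrite subr_eq0 => /eqP NE.
(* As [N] is a multiple of [e] and both have square 1, the factor is 1 or -1; the sign hypothesis
   decides. *)
have : lorentz N e = 1.
  move: NN; rewrite {1}NE lorentzZl (lorentzC e) -expr2 => /eqP.
  rewrite sqrf_eq1 => /orP[/eqP//|/eqP h]; move: Ne; rewrite h; lra.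
by move=> h; rewrite NE h scale1r.
Qed.
End Algebra.

(** * Directional derivatives of compositions, products and squared norms *)

Section Calculus.
Context {R : realType}.

Lemma derive_comp (U V W : normedModType R) (f : U -> V) (g : V -> W) x v :
  differentiable f x -> differentiable g (f x) ->
  'D_v (g \o f) x = 'D_('D_v f x) g (f x).
Proof.
move=> df dg; rewrite (deriveE _ df) (deriveE _ dg).
by rewrite (deriveE _ (differentiable_comp df dg)) diff_comp.
Qed.

(** Expanding in the canonical basis writes [T] as a finite sum of coordinate functions times
    constant vectors. *)
Lemma linear_rV_continuous (W : normedModType R) m
    (T : {linear 'rV[R]_m.+1 -> W}) : continuous T.
Proof.
have TE : (T : _ -> _) = \sum_j (fun u : 'rV[R]_m.+1 => u 0 j *: T (delta_mx 0 j)).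
  apply/funext => u; rewrite fct_sumE {1}[u]row_sum_delta linear_sum.
  by apply: eq_bigr => j _; rewrite linearZ.
move=> u; apply: differentiable_continuous; rewrite TE.
apply: differentiable_sum => j; apply: differentiableZl.
exact: differentiable_coord.
Qed.

Lemma derive_linear (V W : normedModType R) (T : {linear V -> W}) u v :
  continuous T -> 'D_v T u = T v.
Proof.
by move=> cT; rewrite deriveE ?diff_lin//; exact: linear_differentiable.
Qed.

Lemma derive_linear_comp (U V W : normedModType R) (T : {linear V -> W})
    (f : U -> V) u v : continuous T -> differentiable f u ->
  'D_v (T \o f) u = T ('D_v f u).
Proof.
move=> cT df; rewrite (derive_comp v df) ?derive_linear//.
exact: linear_differentiable.
Qed.

(** The Leibniz rule for a scalar times a vector, reduced coordinatewise to the product rule for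
    scalar functions. *)
Lemma derive_scale (V : normedModType R) m (k : V -> R^o) (f : V -> 'rV[R]_m.+1)
    x v : differentiable k x -> differentiable f x ->
  differentiable (fun z => k z *: f z : 'rV[R]_m.+1) x /\
  'D_v (fun z => k z *: f z : 'rV[R]_m.+1) x = 'D_v k x *: f x + k x *: 'D_v f x.
Proof.
move=> dk df.
have dfi j : differentiable (fun z => f z 0 j : R^o) x.
  apply: (@differentiable_comp _ _ _ _ f (fun M : 'rV[R]_m.+1 => M 0 j : R^o)) => //.
  exact: differentiable_coord.
have E : (fun z => k z *: f z) =
    \sum_j (fun z => (k z * f z 0 j) *: (delta_mx 0 j : 'rV[R]_m.+1)).
  apply/funext => z; rewrite fct_sumE {1}[f z]row_sum_delta scaler_sumr.
  by apply: eq_bigr => j _; rewrite scalerA.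
have D : differentiable (fun z => k z *: f z : 'rV[R]_m.+1) x.
  rewrite E; apply: differentiable_sum => j; apply: differentiableZl.
  exact: differentiableM.
split=> //; have := diff_derivable (v := v) D => dD.
rewrite derive_mx//; apply/rowP => j; rewrite !mxE.
have -> : (fun z => (k z *: f z) 0 j) = (k * (fun z => f z 0 j : R^o)).
  by apply/funext => z; rewrite mxE.
rewrite deriveM; [|exact: diff_derivable..].
rewrite (derive_mx (diff_derivable (v := v) df)) mxE /GRing.scale/=.
by ring.
Qed.

Lemma differentiable_dot m (y : 'rV[R]_m.+1) :
  differentiable (fun z : 'rV[R]_m.+1 => dot z z : R^o) y.
Proof.
rewrite (_ : (fun z => _) = \sum_j (fun z : 'rV[R]_m.+1 => z 0 j * z 0 j : R^o)).
  apply: differentiable_sum => j.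
  by apply: differentiableM; exact: differentiable_coord.
by apply/funext => z; rewrite fct_sumE.
Qed.

Lemma derive_dot m (y w : 'rV[R]_m.+1) :
  'D_w (fun z : 'rV[R]_m.+1 => dot z z : R^o) y = 2 * dot y w.
Proof.
have dc j : differentiable (fun z : 'rV[R]_m.+1 => z 0 j : R^o) y.
  exact: differentiable_coord.
rewrite (_ : (fun z => _) = \sum_j ((fun z : 'rV[R]_m.+1 => z 0 j : R^o)
                              * (fun z : 'rV[R]_m.+1 => z 0 j : R^o))); last first.
  by apply/funext => z; rewrite fct_sumE.
rewrite derive_sum; last first.
  by move=> j; apply: derivableM; exact: diff_derivable.
rewrite mulr_sumr; apply: eq_bigr => j _.
rewrite deriveM; [|exact: diff_derivable..].
have -> : 'D_w (fun z : 'rV[R]_m.+1 => z 0 j : R^o) y = w 0 j.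
  have := derive_mx (@derivable_id R _ y w); rewrite derive_id => /rowP/(_ j).
  by rewrite mxE.
by rewrite /GRing.scale/=; ring.
Qed.

End Calculus.

(** * Differentiation on the sphere through radial extensions *)

Section SphereCalculus.
Context {R : realType} {n : nat}.
Local Notation E := 'rV[R]_n.+1.
Implicit Types (x y z w : E).

Lemma sphere_neq0 y : sphere y -> y != 0.
Proof.
move=> hy; apply/eqP => y0; move: hy; rewrite y0 /sphere/= -(scale0r 0) dotZl mul0r.
by move/eqP; rewrite eq_sym oner_eq0.
Qed.

Lemma normalize_id y : sphere y -> normalize y = y.
Proof. by rewrite /sphere /normalize/= => ->; rewrite sqrtr1 invr1 scale1r. Qed.

Lemma sphere_normalize y : y != 0 -> sphere (normalize y).
Proof.
move=> y0; rewrite /sphere /normalize/= dotZl dotZr mulrA -expr2 exprVn.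
have d0 : 0 < dot y y.
  rewrite lt_neqAle; apply/andP; split; last first.
    by apply: sumr_ge0 => i _; rewrite -expr2 sqr_ge0.
  by apply: contraNN y0; rewrite eq_sym => /eqP/dot_self_eq0 ->.
by rewrite sqr_sqrtr ?mulVf ?gt_eqF ?ltW.
Qed.

Lemma normalizeZ a y : 0 < a -> normalize (a *: y) = normalize y.
Proof.
move=> a0; rewrite /normalize dotZl dotZr mulrA -expr2 sqrtrM ?sqr_ge0//.
rewrite sqrtr_sqr gtr0_norm// scalerA invfM mulrAC mulVf ?mul1r//.
by rewrite gt_eqF.
Qed.

(** The scalar factor of [normalize] depends on [dot z z] alone, whose derivative in a tangent
    direction vanishes; only the derivative of the identity is left, with factor 1. *)
Lemma normalize_diff y w : sphere y ->
  differentiable (@normalize R n) y /\ (tangent y w -> 'D_w (@normalize R n) y = w).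
Proof.
move=> hy; have hy' : dot y y = 1 by [].
pose q : E -> R^o := fun z => dot z z.
pose s : R^o -> R^o := fun r => (Num.sqrt r)^-1.
have dq : differentiable q y by exact: differentiable_dot.
have ds : differentiable s (q y).
  apply/derivable1_diffP.
  have -> : s = (fun r => (Num.sqrt r)^-1) by [].
  apply: (@derivableV _ _ (@Num.sqrt R)).
    by rewrite /q hy' sqrtr1 oner_neq0.
  by apply: ex_derive; apply: is_derive1_sqrt; rewrite /q hy'.
have dsq : differentiable (s \o q) y by exact: differentiable_comp.
have did : differentiable (@id E) y by [].
have [D1 D2] := derive_scale w dsq did.
split=> // tw; rewrite -[LHS]/('D_w (fun z => (s \o q) z *: z) y) D2.
rewrite derive_comp// derive_dot tw mulr0 derive0 scale0r add0r.
by rewrite /s /q /= hy' sqrtr1 invr1 scale1r derive_id.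
Qed.

Context {W : normedModType R}.
Implicit Types (f : E -> W) (Om : set E).

Lemma radial_id f y : sphere y -> radial f y = f y.
Proof. by move=> hy; rewrite /radial normalize_id. Qed.

Lemma sphere_openW Om y : sphere_open Om -> Om y -> sphere y.
Proof. by move=> [U _ ->] []. Qed.

Lemma sphere_smooth_diff Om f y : sphere_open Om -> sphere_smooth Om f ->
  Om y -> differentiable (radial f) y.
Proof.
move=> oOm /(_ 1)[+ _] hy; apply.
by rewrite /cone/= normalize_id ?sphere_neq0//; exact: sphere_openW hy.
Qed.

(** The extension is constant along rays, so the difference quotient is 0 as soon as [1 + h] is
    positive. *)
Lemma sdiff_radial f y : sphere y -> sdiff f y y = 0.
Proof.
move=> hy; rewrite /sdiff.
rewrite /derive (_ : (fun h => _) = fun h : R =>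
  h^-1 *: (radial f ((1 + h) *: y) - radial f y)).
  apply: cvg_lim => //; apply: cvg_near_cst.
  near=> h; rewrite /radial normalizeZ ?subrr ?scaler0//.
  have : `|h| < 1 by near: h; exact: dnbhs0_lt.
  rewrite ltr_norml => /andP[h1 _]; lra.
by apply/funext => h; rewrite /= scalerDl scale1r [y + _]addrC.
Unshelve. all: by end_near. Qed.

(** [Om] is open only relative to the sphere, so [h] has to take values there. This makes identities
    valid on [Om] hold in a full neighbourhood, where they can be differentiated. *)
Lemma near_sphere_open Om y (h : E -> E) : sphere_open Om ->
  (\forall z \near y, sphere (h z)) -> {for y, continuous h} -> Om (h y) ->
  \forall z \near y, Om (h z).
Proof.
move=> [U oU ->] hs ch [Uy _].
have : \forall z \near y, U (h z) by apply: ch; exact: open_nbhs_nbhs.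
by apply: filterS2 hs => z; split.
Qed.

Lemma near_normalize y : sphere y -> \forall z \near y, sphere (normalize z).
Proof.
move=> hy; have : nbhs y [set z | z != 0].
  apply: open_nbhs_nbhs; split; last exact: sphere_neq0.
  rewrite (_ : mkset _ = ~` [set 0]); last by apply/seteqP; split=> z /= /eqP.
  apply/closed_openC/accessible_closed_set1/hausdorff_accessible.
  exact: norm_hausdorff.
by apply: filterS => z; exact: sphere_normalize.
Qed.

End SphereCalculus.

(** * Equivariant maps, the light cone map, and conformal invariance *)

Section Equivariance.
Context {R : realType} {n : nat}.
Local Notation E := 'rV[R]_n.+1.
Local Notation L := 'rV[R]_(1 + n.+1).
Implicit Types (x y z w : E) (Om : set E).

(** The chain rule for f = T o f o F. The relation is known only where [q] and [F q] both lie in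
    [Om], but by continuity of [F] this covers all directions near [y]. *)
Lemma sdiff_equivariant (W : normedModType R) (f : E -> W) (T : {linear W -> W})
    (F : E -> E) Om y w :
  continuous T -> sphere_open Om -> sphere_smooth sphere F ->
  (forall q, sphere q -> sphere (F q)) ->
  (forall q, Om q -> Om (F q) -> f q = T (f (F q))) ->
  Om y -> Om (F y) -> differentiable (radial f) (F y) ->
  sdiff f y w = T (sdiff f (F y) (sdiff F y w)).
Proof.
move=> cT oOm sF FS hf hy hFy df; have Sy := sphere_openW oOm hy.
have dF : differentiable (radial F) y.
  apply: sphere_smooth_diff sF Sy.
  by exists setT; [exact: openT|rewrite setTI].
have Fy : radial F y = F y by exact: radial_id.
have df' : differentiable (radial f) (radial F y) by rewrite Fy.
have dc := differentiable_comp dF df'.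
have nE : \near y, radial f y = (T \o (radial f \o radial F)) y.
  have nS := near_normalize Sy.
  have n1 : \forall z \near y, Om (normalize z).
    apply: (near_sphere_open (h := @normalize R n)) oOm _ _ _ => //;
      last by rewrite normalize_id.
    exact/differentiable_continuous/(normalize_diff 0 Sy).1.
  have n2 : \forall z \near y, Om (radial F z).
    apply: (near_sphere_open (h := radial F)) oOm _ _ _ => //;
      last by rewrite Fy.
      by apply: filterS nS => z; exact: FS.
    exact: differentiable_continuous.
  near=> z.
  have Sz : sphere (normalize z) by near: z.
  rewrite /= /radial (normalize_id (FS _ Sz)); apply: hf; first by near: z.
  by rewrite -/(radial F z); near: z.
rewrite /sdiff (near_eq_derive _ nE) (derive_linear_comp w cT dc).
by rewrite (derive_comp w dF df') Fy.
Unshelve. all: by end_near. Qed.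

(** Differentiating <h, h> = c gives 2 <h, dh> = 0. Time and spatial part are treated as two linear
    maps composed with [h]. *)
Lemma lorentz_derive_normal (V : normedModType R) (h : V -> L) (c : R) (v w : V) :
  differentiable h v -> (\forall z \near v, lorentz (h z) (h z) = c) ->
  lorentz (h v) ('D_w h v) = 0.
Proof.
move=> dh hc.
have lt : linear (fun u : L => time u : R^o).
  by move=> a u u'; rewrite timeD timeZ.
pose Ht := GRing.isLinear.Build _ _ _ _ _ lt.
pose tl : {linear L -> R^o} := HB.pack (fun u : L => time u : R^o) Ht.
have lr : linear (fun u : L => rsubmx u : E).
  by move=> a u u'; rewrite rsubmxD rsubmxZ.
pose Hr := GRing.isLinear.Build _ _ _ _ _ lr.
pose rl : {linear L -> E} := HB.pack (fun u : L => rsubmx u : E) Hr.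
have ct : continuous tl := @linear_rV_continuous R _ n.+1 tl.
have cr : continuous rl := @linear_rV_continuous R _ n.+1 rl.
have dth : differentiable (tl \o h) v.
  by apply: differentiable_comp => //; exact: linear_differentiable.
have drh : differentiable (rl \o h) v.
  by apply: differentiable_comp => //; exact: linear_differentiable.
pose q : E -> R^o := fun z => dot z z.
have dq : differentiable (q \o (rl \o h)) v.
  by apply: differentiable_comp => //; exact: differentiable_dot.
have /near_eq_derive : \near v,
    (- ((tl \o h) * (tl \o h) : V -> R^o) + (q \o (rl \o h))) v
    = cst (c : R^o) v by exact: hc.
move=> /(_ w); rewrite derive_cst deriveD; last 2 first.
- by apply: diff_derivable; apply: differentiableN; exact: differentiableM.
- exact: diff_derivable.
rewrite deriveN; last by apply: diff_derivable; exact: differentiableM.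
rewrite deriveM; [|exact: diff_derivable..].
rewrite (derive_comp _ drh); last exact: differentiable_dot.
rewrite derive_dot (derive_linear_comp w ct dh) (derive_linear_comp w cr dh).
rewrite /= /GRing.scale/= /lorentz => e.
have : 2 * (- (time (h v) * time ('D_w h v)) +
    dot (rsubmx (h v)) (rsubmx ('D_w h v))) = 0.
  rewrite -e; ring.
by move/eqP; rewrite mulf_eq0 pnatr_eq0 => /eqP.
Qed.

Definition light_cone_map (rho : E -> R) x : L := expR (rho x) *: lpt 1 x.

Lemma lptD (s t : R) x y : lpt (s + t) (x + y) = lpt s x + lpt t y.
Proof. by rewrite /lpt add_row_mx -raddfD. Qed.

Lemma lptZ (a t : R) x : lpt (a * t) (a *: x) = a *: lpt t x.
Proof. by rewrite /lpt scale_row_mx scale_scalar_mx. Qed.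

(** The Leibniz rule for e^rho times (1, x); tangency of [w] ensures that the differential of
    [normalize] fixes it. *)
Lemma light_cone_map_sdiff (rho : E -> R) y w : sphere y ->
  differentiable (radial rho : E -> R^o) y ->
  differentiable (radial (light_cone_map rho)) y /\
  (tangent y w -> sdiff (light_cone_map rho) y w =
    expR (rho y) *: (sdiff (rho : E -> R^o) y w *: lpt 1 y + lpt 0 w)).
Proof.
move=> Sy dr.
have ll : linear (lpt 0 : E -> L).
  by move=> a u u'; rewrite -lptZ -lptD mulr0 addr0.
pose Hl := GRing.isLinear.Build _ _ _ _ _ ll.
pose l0 : {linear E -> L} := HB.pack (lpt 0 : E -> L) Hl.
have cl : continuous l0 by exact: linear_rV_continuous.
have [dn Dn] := normalize_diff w Sy.
have dl : differentiable (l0 \o @normalize R n) y.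
  by apply: differentiable_comp => //; exact: linear_differentiable.
pose k : E -> R^o := (expR : R^o -> R^o) \o (radial rho : E -> R^o).
have de (r : R) : differentiable (expR : R^o -> R^o) r.
  by apply/derivable1_diffP; exact: derivable_expR.
have dk : differentiable k y by exact: differentiable_comp.
pose f : E -> L := cst (lpt 1 0) + (l0 \o @normalize R n).
have df : differentiable f y by exact: differentiableD.
have fE z : f z = lpt 1 (normalize z).
  by rewrite -[LHS]/(lpt 1 0 + lpt 0 (normalize z)) -lptD addr0 add0r.
(* [1 + n.+1] is convertible to [n.+1.+1]; the annotation gives the successor form that
   [derive_scale] expects. *)
have E1 : radial (light_cone_map rho) = (fun z => k z *: (f z : 'rV[R]_(n.+1).+1)).
  by apply/funext => z; rewrite fE.
have [D1 D2] := derive_scale w dk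
  (df : differentiable (f : E -> 'rV[R]_(n.+1).+1) y).
rewrite /sdiff E1; split=> // tw; rewrite D2.
have -> : 'D_w (f : E -> 'rV[R]_(n.+1).+1) y = lpt 0 w.
  rewrite deriveD; [|exact: diff_derivable..].
  by rewrite derive_cst add0r (derive_linear_comp w cl dn) Dn.
rewrite fE /k (derive_comp w dr (de _)) radial_id// normalize_id//.
rewrite scalerDr scalerA; congr (_ *: _ + _ *: _); last by rewrite /= radial_id.
rewrite deriveE// deriv1E; last exact: derivable_expR.
by rewrite derive1E derive_val /GRing.scale/= mulrC.
Qed.

(** The time coordinate determines the exponent, and then the spatial part determines the point;
    thus a value of the light cone map determines support function and Gauss map. *)
Lemma lpt_ray_inj (a b : R) x y :
  expR a *: lpt 1 x = expR b *: lpt 1 y -> a = b /\ x = y.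
Proof.
rewrite -!lptZ !mulr1 /lpt => /eq_row_mx[/matrixP/(_ 0 0)].
rewrite !mxE !mulr1n => /expR_inj -> /eqP.
rewrite -subr_eq0 -scalerBr scaler_eq0 gt_eqF ?expR_gt0//=.
by rewrite subr_eq0 => /eqP.
Qed.

(** Pulling back by [Phi] multiplies [dot u v] by a power of e, so the two metrics agree iff the
    exponents do; one nonzero tangent vector suffices to compare them. *)
Lemma conformal_invariantP Om rho Phi om : (0 < n)%N ->
  sphere_open Om -> conformal_diffeo Phi om ->
  metric_invariant Om (conf_metric rho) Phi <->
  (forall x, Om x -> Om (Phi x) -> rho x = rho (Phi x) + om x).
Proof.
move=> n0 oOm [_ hc]; split=> [h x hx hPx|h x hx hPx u v tu tv]; last first.
  rewrite /conf_metric hc//; last exact: sphere_openW hx.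
  by rewrite mulrA -expRD h// mulrDr.
have [v tv v0] := exists_tangent x n0.
have := h x hx hPx v v tv tv.
rewrite /conf_metric hc//; last exact: sphere_openW hx.
rewrite mulrA -expRD => /mulIf/expR_inj H.
have : 2 * rho x = 2 * rho (Phi x) + 2 * om x.
  by apply: H; apply: contra_neq v0; exact: dot_self_eq0.
lra.
Qed.

End Equivariance.

(** * Recovering the hypersurface from its light cone map *)

Section Representation.
Context {R : realType} {n : nat}.
Local Notation E := 'rV[R]_n.+1.
Local Notation L := 'rV[R]_(1 + n.+1).
Implicit Types (x y z w : E) (Om : set E) (rho : E -> R).

Lemma dot_sgrad rho y w : differentiable (radial rho : E -> R^o) y ->
  dot (sgrad rho y) w = sdiff (rho : E -> R^o) y w.
Proof.
move=> dr; rewrite /sdiff (deriveE _ dr) {2}[w]row_sum_delta linear_sum.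
apply: eq_bigr => j _; rewrite mxE linearZ /sdiff (deriveE _ dr).
by rewrite mulrC.
Qed.

Lemma repr_hypersurface_lpt rho y : let k := expR (- rho y) in
  let s := expR (rho y) / 2 *
     (1 + expR (- 2 * rho y) * (1 + dot (sgrad rho y) (sgrad rho y))) in
  repr_hypersurface rho y = lpt s ((s - k) *: y + k *: sgrad rho y).
Proof.
move=> k s; rewrite /repr_hypersurface -/k -/s -!lptZ -lptD mulr1 mulr0 addr0.
by congr lpt; rewrite scalerBl scalerDr scalerN addrA.
Qed.

Lemma time_lpt t x : time (lpt t x) = t.
Proof. by rewrite /time /lpt row_mxKl mxE mulr1n. Qed.

Lemma rsubmx_lpt t x : rsubmx (lpt t x) = x.
Proof. exact: row_mxKr. Qed.

(** Write P = (t, p) and k = e^(-rho). The product with psi fixes the component of [p] along [y] as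
    t - k, the products with d psi fix its tangential part as k grad rho, and <P, P> = -1 then
    determines [t]. *)
Lemma repr_hypersurfaceP rho y (P : L) : sphere y ->
  differentiable (radial rho : E -> R^o) y ->
  P = repr_hypersurface rho y <->
  [/\ lorentz P P = -1, lorentz P (light_cone_map rho y) = -1 &
      forall w, tangent y w -> lorentz P (sdiff (light_cone_map rho) y w) = 0].
Proof.
move=> Sy dr; have yy : dot y y = 1 by [].
pose gr := sgrad rho y; pose k := expR (- rho y); pose G := dot gr gr.
have k0 : k != 0 by rewrite gt_eqF ?expR_gt0.
have erho : expR (rho y) = k^-1 by rewrite /k expRN invrK.
have e2 : expR (- 2 * rho y) = k ^+ 2.
  by rewrite /k expr2 -expRD; congr expR; ring.
have gy : dot gr y = 0 by rewrite dot_sgrad// sdiff_radial.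
have yg : dot y gr = 0 by rewrite dotC.
have Epsi (Q : L) : lorentz Q (light_cone_map rho y) =
    k^-1 * (- time Q + dot (rsubmx Q) y).
  by rewrite /light_cone_map lorentzZr lorentz_lptr mulr1 erho.
have Edpsi (Q : L) w : tangent y w ->
    lorentz Q (sdiff (light_cone_map rho) y w) =
    k^-1 * (dot gr w * (- time Q + dot (rsubmx Q) y) + dot (rsubmx Q) w).
  move=> tw; rewrite (light_cone_map_sdiff w Sy dr).2// lorentzZr lorentzDr.
  by rewrite lorentzZr !lorentz_lptr mulr1 mulr0 oppr0 add0r erho dot_sgrad.
rewrite repr_hypersurface_lpt -/gr -/k -/G erho e2.
set s := k^-1 / 2 * _.
have sE : 2 * s * k = 1 + k ^+ 2 * (1 + G) by rewrite /s; field.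
split=> [->|[PP Ppsi Pdpsi]].
  have cy : dot ((s - k) *: y + k *: gr) y = s - k.
    by rewrite dotDl !dotZl yy gy; ring.
  split.
  - rewrite lorentz_lptr time_lpt rsubmx_lpt dotDr !dotZr cy dotDl !dotZl yg -/G.
    by transitivity (k ^+ 2 * (1 + G) - 2 * s * k); [ring|rewrite sE; ring].
  - by rewrite Epsi time_lpt rsubmx_lpt cy; field.
  - move=> w tw; rewrite Edpsi// time_lpt rsubmx_lpt cy dotDl !dotZl.
    by rewrite (tw : dot y w = 0); ring.
pose t := time P; pose p := rsubmx P.
have tp : - t + dot p y = - k.
  by move: Ppsi; rewrite Epsi -/t -/p => /(congr1 ( *%R k)); rewrite mulVKf// mulrN1.
(* By the third condition [p - k *: gr] is orthogonal to every tangent vector, hence a multiple of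
   [y]. *)
have pE : p = (t - k) *: y + k *: gr.
  have : p - k *: gr = dot (p - k *: gr) y *: y.
    apply: dot_tangent_eq => // w tw; move: (Pdpsi w tw).
    rewrite Edpsi// -/t -/p tp => /eqP.
    rewrite mulf_eq0 invr_eq0 (negPf k0)/= => /eqP h.
    by rewrite dotDl dotNl dotZl -h; ring.
  rewrite dotDl dotNl dotZl gy mulr0 subr0 => /eqP; rewrite subr_eq => /eqP ->.
  by congr (_ *: _ + _); move: tp; lra.
(* The terms in t^2 cancel in <P, P>, which leaves an equation linear in [t], the one that [s]
   satisfies by [sE]. *)
have tE : t = s.
  have h : 2 * t * k = 1 + k ^+ 2 * (1 + G).
    move: PP; rewrite /lorentz -/t -/p pE dotDr !dotZr !dotDl !dotZl yy gy yg -/G.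
    by move=> h; apply: (@addrI _ (-1)); rewrite -{1}h; ring.
  have : (2 * k) * t = (2 * k) * s by rewrite mulrAC h -sE; ring.
  by apply: mulfI; rewrite mulf_neq0// pnatr_eq0.
by rewrite [P]lpt_eta -/t -/p pE tE.
Qed.

End Representation.

(** * Invariance of the hypersurface against the transformation law of [rho] *)

Section Invariance.
Context {R : realType} {n : nat}.
Local Notation E := 'rV[R]_n.+1.
Local Notation L := 'rV[R]_(1 + n.+1).
Implicit Types (x y z w : E) (Om : set E) (rho : E -> R).

(** Since the normal direction is killed, any direction may be replaced by its tangential
    projection; this extends statements about tangent vectors to all vectors. *)
Lemma sdiff_tangentE (W : normedModType R) (f : E -> W) y w : sphere y ->
  differentiable (radial f) y ->
  tangent y (w - dot w y *: y) /\ sdiff f y w = sdiff f y (w - dot w y *: y).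
Proof.
move=> Sy df; split.
  by rewrite /tangent dotDr dotNr dotZr (Sy : dot y y = 1) mulr1 (dotC y) subrr.
have := sdiff_radial f Sy; rewrite /sdiff !(deriveE _ df) => y0.
by rewrite linearB linearZ /= y0 scaler0 subr0.
Qed.

Context (Om : set E) (rho : E -> R) (Phi : E -> E) (om : E -> R).
Context (T : {linear L -> L}).
Context (oOm : sphere_open Om) (hT : lorentz_isometry T)
  (hTPhi : associated T Phi om).

Let cT : continuous T. Proof. exact: (@linear_rV_continuous R _ n.+1 T). Qed.

(** [T] maps [phi x] to [phi y] with y = iT x, and by uniqueness of the unit normal [eta x] to
    [eta y]. Their sums give T (psi x) = psi y, a point on the ray of [Phi x]; hence y = Phi x, and
    the scales compare. *)
Lemma support_invariant_of_isometry (phi eta : E -> L) :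
  hypersurface Om phi eta -> has_support_gauss Om phi eta rho id ->
  isometry_invariant Om phi eta T Phi ->
  forall x, Om x -> Om (Phi x) -> rho x = rho (Phi x) + om x.
Proof.
move=> [[sphi seta] hhyp imm ep ed] hpsi.
move=> [iT [[F' [hS _ sF' F'K KF']] Tphi Tor hdom]] x hx hPx.
(* That [iT x] equals [Phi x] comes out only at the end, so its membership in [Om] is taken from the
   last clause of invariance. *)
have hy := hdom x hx hPx; set y := iT x in hy.
have Sx := sphere_openW oOm hx; have Sy := sphere_openW oOm hy.
have F'y : F' y = x by exact: F'K.
have dphi z : Om z -> differentiable (radial phi) z.
  exact: sphere_smooth_diff oOm sphi.
have ed' z w : Om z -> lorentz (eta z) (sdiff phi z w) = 0.
  move=> hz.
  have [t ->] := sdiff_tangentE w (sphere_openW oOm hz) (dphi z hz).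
  exact: ed.
have pp w : lorentz (phi y) (sdiff phi y w) = 0.
  rewrite -(radial_id phi Sy).
  apply: (lorentz_derive_normal (c := -1)); first exact: dphi.
  have : \forall z \near y, Om (normalize z).
    apply: (near_sphere_open (h := @normalize R n)) oOm _ _ _.
    - exact: near_normalize.
    - exact/differentiable_continuous/(normalize_diff 0 Sy).1.
    - by rewrite normalize_id.
  by apply: filterS => z /hhyp[[]].
(* Invariance is differentiated along the inverse [F'] of [iT]: every tangent vector of the
   hypersurface at [y] becomes a [T]-image of one at [x], so [T (eta x)] is normal at [y]. *)
have equi w : sdiff phi y w = T (sdiff phi x (sdiff F' y w)).
  rewrite -F'y; apply: sdiff_equivariant cT oOm sF' _ _ hy _ _ => //.
  - by move=> q /hS[].
  - move=> q hq hFq; have Sq := sphere_openW oOm hq.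
    by rewrite Tphi ?KF'.
  - by rewrite F'y.
  - by rewrite F'y; exact: dphi.
have [lT _ _] := hT.
have Teta : T (eta x) = eta y.
  pose A : {linear E -> L} := 'd (radial phi) y.
  have AE w : A w = sdiff phi y w by rewrite /sdiff deriveE//; exact: dphi.
  apply: (@unit_normal_unique R n y (phi y) (eta y) (T (eta x)) A) => //.
  - by rewrite AE sdiff_radial.
  - by have [[]] := hhyp y hy.
  - by have [] := hhyp y hy.
  - exact: ep.
  - by move=> w; rewrite AE.
  - by move=> w; rewrite AE ed'.
  - by move=> w tw; rewrite AE; exact: imm.
  - by rewrite -Tphi// lT ep.
  - by move=> w; rewrite AE equi lT ed'.
  - by rewrite lT; have [] := hhyp x hx.
  - exact: Tor.
have := hpsi y hy; rewrite -Teta -Tphi// -linearD hpsi// hTPhi//.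
by move=> /lpt_ray_inj[e /= yE]; rewrite yE; lra.
Qed.

(** The law for [rho] says that [T] maps psi at [x] to psi at [Phi x]. The products characterizing
    phi are preserved by [T], so the same holds for phi, and for the normal psi - phi. *)
Lemma repr_hypersurface_invariant : sphere_diffeo Phi ->
  sphere_smooth Om (rho : E -> R^o) ->
  (forall x, Om x -> Om (Phi x) -> rho x = rho (Phi x) + om x) ->
  isometry_invariant Om (repr_hypersurface rho) (repr_normal rho) T Phi.
Proof.
move=> dPhi srho hrho; have [lT _ _] := hT.
have [F' [hS _ sF' F'K KF']] := dPhi.
have drho z : Om z -> differentiable (radial rho : E -> R^o) z.
  exact: sphere_smooth_diff oOm srho.
have Tpsi x : Om x -> Om (Phi x) ->
    T (light_cone_map rho x) = light_cone_map rho (Phi x).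
  move=> hx hPx; rewrite /light_cone_map hTPhi; last exact: sphere_openW hx.
  by rewrite (hrho x)// addrK.
have Tphi x : Om x -> Om (Phi x) ->
    T (repr_hypersurface rho x) = repr_hypersurface rho (Phi x).
  move=> hx hy; set y := Phi x in hy *.
  have Sx := sphere_openW oOm hx; have Sy := sphere_openW oOm hy.
  have [pp ppsi pdpsi] :=
    (repr_hypersurfaceP (repr_hypersurface rho x) Sx (drho x hx)).1 erefl.
  have F'y : F' y = x by exact: F'K.
  have dpsi := (light_cone_map_sdiff 0 Sx (drho x hx)).1.
  apply/(repr_hypersurfaceP _ Sy (drho y hy)); split.
  - by rewrite lT.
  - by rewrite -Tpsi// lT.
  (* Through the inverse of [Phi], d psi at [y] is the [T]-image of d psi at [x], and [T] cancels
     from the product. *)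
  - move=> w tw; rewrite (sdiff_equivariant (T := T) (F := F') (Om := Om))//.
    + rewrite lT F'y; have [t ->] := sdiff_tangentE (sdiff F' y w) Sx dpsi.
      exact: pdpsi.
    + by move=> q /hS[].
    + by move=> q hq hFq; rewrite Tpsi ?KF'//; exact: sphere_openW hq.
    + by rewrite F'y.
    + by rewrite F'y.
exists Phi; split=> // x hx hPx.
have Sy := sphere_openW oOm hPx.
have [pp ppsi _] := (repr_hypersurfaceP (repr_hypersurface rho (Phi x)) Sy
  (drho _ hPx)).1 erefl.
have -> : T (repr_normal rho x) = repr_normal rho (Phi x).
  by rewrite /repr_normal linearB /= Tphi// -/(light_cone_map rho x) Tpsi.
rewrite /repr_normal -/(light_cone_map rho (Phi x)).
(* The normal psi - phi has square 0 + 2 - 1 = 1, which gives the required positive sign. *)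
have psi0 : lorentz (light_cone_map rho (Phi x)) (light_cone_map rho (Phi x)) = 0.
  rewrite lorentzZl lorentzZr lorentz_lptr time_lpt rsubmx_lpt.
  by rewrite (Sy : dot _ _ = 1) mulr1 addNr !mulr0.
rewrite lorentzBl !(lorentzC _ (_ - _)) !lorentzBl psi0 pp ppsi.
by rewrite (lorentzC (light_cone_map _ _)) ppsi; lra.
Qed.

End Invariance.

(** * Both implications, by way of the law rho = rho o Phi + om *)

Theorem lemma3p1 (R : realType) (n : nat) (hn : (3 <= n)%N)
    (Om : set 'rV[R]_n.+1) (hOm : sphere_domain Om)
    (rho : 'rV[R]_n.+1 -> R)
    (Phi : 'rV[R]_n.+1 -> 'rV[R]_n.+1) (om : 'rV[R]_n.+1 -> R)
    (hPhi : conformal_diffeo Phi om)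
    (T : {linear 'rV[R]_(1 + n.+1) -> 'rV[R]_(1 + n.+1)})
    (hT : lorentz_isometry T) (hTPhi : associated T Phi om) :
  (forall phi eta : 'rV[R]_n.+1 -> 'rV[R]_(1 + n.+1),
     hypersurface Om phi eta ->
     horo_convex Om phi eta ->
     has_support_gauss Om phi eta rho id ->
     isometry_invariant Om phi eta T Phi ->
     metric_invariant Om (conf_metric rho) Phi)
  /\
  (sphere_smooth Om (rho : 'rV[R]_n.+1 -> R^o) ->
   schouten_eigenvalues_lt Om (conf_metric rho) (1 / 2) ->
   metric_invariant Om (conf_metric rho) Phi ->
   isometry_invariant Om (repr_hypersurface rho) (repr_normal rho) T Phi).
Proof.
have [_ oOm _] := hOm.
have n0 : (0 < n)%N by exact: leq_trans hn.
have invP := conformal_invariantP rho n0 oOm hPhi.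
split=> [phi eta hphi _ hsupp hinv|srho _ hinv].
  apply: invP.2.
  exact: (support_invariant_of_isometry oOm hT hTPhi hphi hsupp hinv).
exact: (repr_hypersurface_invariant oOm hT hTPhi hPhi.1 srho (invP.1 hinv)).
Qed.
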